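(* Let $m\ge 1$ and $n\ge m+3$ be integers, and define a vector $v$ indexed by the $(m+1)$-subsets $S$ of $\{1,\dots,n\}$ by $v(S)=1$ if $1\in S$ and $v(S)=0$ if $1\notin S$. Then $v$ generates an extreme ray of the cone $SMET^{m,m}_n$. Its graph $G_v$ is the Johnson graph $J(n-1,m)$, and the orbit (under $Sym(n)$) of extreme rays represented by $v$ has size $n$.
   Context: Let $V_n=\{1,\dots,n\}$ and let $\binom{V_n}{m+1}$ be the set of $(m+1)$-subsets of $V_n$. For $d\in\mathbb{R}^{\binom{V_n}{m+1}}$, an $(m+2)$-subset $T\subset V_n$ and $i\in T$, the $(m,s)$-simplex inequality is $$s\, d(T\setminus\{i\})\le \sum_{k\in T\setminus\{i\}} d(T\setminus\{k\}),$$ and for an $(m+1)$-subset $A\subset V_n$ the non-negativity inequality is $d(A)\ge 0$. The cone $SMET^{m,s}_n\subset\mathbb{R}^{\binom{V_n}{m+1}}$ of $(m,s)$-super-metrics is the set of all $d$ satisfying all $(m,s)$-simplex inequalities and all non-negativity inequalities on $V_n$; $SMET^{m,m}_n$ is the case $s=m$. An extreme ray of a polyhedral cone is a face of dimension $1$. The group $Sym(n)$ acts on $SMET^{m,s}_n$ by permuting the elements of $V_n$. The Johnson graph $J(N,k)$ has the $k$-subsets of an $N$-set as vertices, two being adjacent when they share $k-1$ elements. For a $0,1$-valued vector $v\in\mathbb{R}^{\binom{V_n}{m+1}}$, $G_v$ is the subgraph of $J(n,m+1)$ induced on the support of $v$, i.e. on the set of $(m+1)$-subsets $S$ with $v(S)\neq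 0$; equality of graphs is up to isomorphism. *)

(* Defs.v *)
From HB Require Import structures.
From mathcomp Require Import all_boot all_order all_algebra all_fingroup.
From mathcomp Require Import boolp classical_sets cardinality reals.

Set Implicit Arguments.
Unset Strict Implicit.
Unset Printing Implicit Defensive.

Import Order.TTheory GRing.Theory Num.Theory.

Local Open Scope classical_set_scope.
Local Open Scope ring_scope.

(* V_n is encoded as 'I_n = {0, ..., n-1}; the element 1 of the usual
   {1, ..., n} becomes the ordinal of value 0. *)
Definition ksubset (n k : nat) := {S : {set 'I_n} | #|S| == k}.

(* The value type is R^o so that this is canonically a vectType over R. *)
Definition vec (R : realFieldType) (n k : nat) := {ffun ksubset n k -> R^o}.

(* The value 0 on sets of cardinality different from k is a dummy. *)
Definition coord_at (R : realFieldType) (n k : nat) (d : vec R n k)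
    (A : {set 'I_n}) : R :=
  if insub A is Some B then d B else 0.

Definition simplex_ineq (R : realFieldType) (n m : nat) (s : R)
    (d : vec R n m.+1) (T : {set 'I_n}) (i : 'I_n) : Prop :=
  s * coord_at d (T :\ i) <= \sum_(k in T :\ i) coord_at d (T :\ k).

Definition SMET (R : realFieldType) (n m : nat) (s : R) : set (vec R n m.+1) :=
  [set d | (forall (T : {set 'I_n}) (i : 'I_n),
              #|T| = m.+2 -> i \in T -> simplex_ineq s d T i)
        /\ (forall A : {set 'I_n}, #|A| = m.+1 -> 0 <= coord_at d A)].

(* Faces of a cone are cut out by its valid homogeneous inequalities. *)
Definition is_face (R : realFieldType) (V : vectType R) (C F : set V) : Prop :=
  exists f : {linear V -> R^o},
    (forall x, C x -> (0 : R) <= f x) /\ F = [set x | C x /\ f x = 0].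

(* Dimension of the linear span; for a face of a cone, which contains 0, this
   is also the dimension of the affine hull. *)
Definition has_dim (R : realFieldType) (V : vectType R) (F : set V) (k : nat) :
    Prop :=
  exists U : {vspace V},
    [/\ forall x, F x -> x \in U,
        forall W : {vspace V}, (forall x, F x -> x \in W) -> (U <= W)%VS
      & \dim U = k].

Definition is_extreme_ray (R : realFieldType) (V : vectType R) (C F : set V) :
    Prop :=
  is_face C F /\ has_dim F 1.

Definition ray (R : realFieldType) (V : vectType R) (v : V) : set V :=
  [set l *: v | l in [set l : R | 0 <= l]].

Fact perm_ksubset_proof (n k : nat) (s : 'S_n) (S : ksubset n k) :
  #|s @: val S| == k.
Proof. by rewrite card_imset ?(valP S) //; exact: perm_inj. Qed.

Definition perm_ksubset (n k : nat) (s : 'S_n) (S : ksubset n k) :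
    ksubset n k :=
  exist _ (s @: val S) (perm_ksubset_proof s S).

Definition perm_vec (R : realFieldType) (n k : nat) (s : 'S_n)
    (d : vec R n k) : vec R n k :=
  [ffun S => d (perm_ksubset s^-1%g S)].

Definition ray_orbit (R : realFieldType) (n k : nat) (v : vec R n k) :
    set (set (vec R n k)) :=
  [set [set perm_vec s x | x in ray v] | s in [set: 'S_n]].

(* The successor form of "share k-1 elements" leaves no loop when k = 0. *)
Definition johnson_adj (n k : nat) : rel (ksubset n k) :=
  fun A B => #|val A :&: val B|.+1 == k.

Definition supp (R : realFieldType) (n k : nat) (v : vec R n k) :=
  {S : ksubset n k | v S != 0}.

Definition supp_adj (R : realFieldType) (n k : nat) (v : vec R n k) :
    rel (supp v) :=
  fun A B => johnson_adj (val A) (val B).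

Definition graph_iso (T1 T2 : finType) (e1 : rel T1) (e2 : rel T2) : Prop :=
  exists2 f : T1 -> T2, bijective f & forall x y, e2 (f x) (f y) = e1 x y.

Definition star_vec (R : realFieldType) (n k : nat) : vec R n k :=
  [ffun S : ksubset n k =>
     (if [exists i in val S, val i == 0%N] then 1 else 0) : R^o].

(* Main.v *)
Require Import Defs.
From HB Require Import structures.
From mathcomp Require Import all_boot all_order all_algebra all_fingroup.
From mathcomp Require Import boolp classical_sets cardinality reals.

Set Implicit Arguments.
Unset Strict Implicit.
Unset Printing Implicit Defensive.

Import Order.TTheory GRing.Theory Num.Theory.

Local Open Scope classical_set_scope.
Local Open Scope card_scope.
Local Open Scope ring_scope.

(** Write [star i] for the indicator of the sets that contain the point [i];
    the vector of the theorem is the star of the first point.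

    Extremality.  The face that isolates the ray is cut out by the single
    valid inequality [0 <= \sum_(A | i \notin A) d A], a sum of non-negativity
    constraints ([off_star]).  On this face [d] vanishes off the star, so for
    [T] of size [m + 2] containing [i] the [m + 1] numbers [d (T :\ k)], with
    [k != i] in [T], have the same sum as all the [d (T :\ k)].  The simplex
    inequalities at [T] then say that each of these numbers is at most their
    mean, so they are all equal ([le_mean_const]): two sets of the star that
    differ by one exchange have the same value.  Any two sets of the star are
    joined by such exchanges ([exchange_const]), so [d] is a multiple of
    [star i].

    Graph.  Deleting [i] turns a set of the star into an [m]-subset of the
    [n - 1] remaining points and lowers the size of intersections by one.

    Orbit.  A permutation [s] sends [star i] to [star (s i)], so the orbit is
    the family of all rays of stars; these are distinct because, for [i != j],
    some [(m + 1)]-subset contains [i] and avoids [j]. *)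

(** * Coordinates and stars *)

Section Coordinates.
Variables (R : realFieldType) (n k : nat).

Lemma card_ksubset (S : ksubset n k) : #|val S| = k.
Proof. exact: (eqP (valP S)). Qed.

Lemma coord_at_val (d : vec R n k) (S : ksubset n k) :
  coord_at d (val S) = d S.
Proof. by rewrite /coord_at valK. Qed.

Lemma coord_atZ (l : R) (d : vec R n k) (A : {set 'I_n}) :
  coord_at (l *: d) A = l * coord_at d A.
Proof.
by rewrite /coord_at; case: insubP => [S _ _|_]; rewrite ?mulr0 ?ffunE.
Qed.

Definition star (i : 'I_n) : vec R n k :=
  [ffun S : ksubset n k => (i \in val S)%:R : R^o].

Lemma coord_at_star (i : 'I_n) (A : {set 'I_n}) :
  #|A| = k -> coord_at (star i) A = (i \in A)%:R.
Proof.
move=> /eqP cA; rewrite -[A in LHS](SubK (ksubset n k) cA) coord_at_val.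
by rewrite ffunE SubK.
Qed.

Lemma star_vecE (i : 'I_n) : val i = 0%N -> star_vec R n k = star i.
Proof.
move=> i0; apply/ffunP => S; rewrite !ffunE.
have -> : [exists j in val S, val j == 0%N] = (i \in val S).
  apply/exists_inP/idP => [[j jS /eqP j0]|iS]; last by exists i; rewrite ?i0.
  by have <- : j = i by apply: val_inj; rewrite j0.
by case: (i \in val S).
Qed.

End Coordinates.

Lemma exists_separating_subset (n k : nat) (i j : 'I_n) :
  i != j -> (k.+2 <= n)%N ->
  exists A : {set 'I_n}, [/\ #|A| = k.+1, i \in A & j \notin A].
Proof.
move=> ij kn; pose D := ~: [set i; j].
have cD : #|D| = (n - 2)%N.
  by rewrite -[n in RHS]card_ord -(cardsC [set i; j]) cards2 ij addKn.
have : (0 < #|[set A : {set 'I_n} | A \subset D & #|A| == k]|)%N.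
  by rewrite cards_draws bin_gt0 cD leq_subRL ?(leq_trans _ kn).
case/card_gt0P => A; rewrite inE => /andP[/fintype.subsetP AD /eqP cA].
exists (i |: A); split; rewrite ?setU11 //.
  rewrite cardsU1 cA; case: (boolP (i \in A)) => // /AD.
  by rewrite !inE eqxx.
rewrite !inE negb_or eq_sym ij /=; apply/negP => /AD.
by rewrite !inE eqxx orbT.
Qed.

(** * The extreme ray *)

(** The gaps between the sum and [#|A|] times each term are non-negative and add
    up to zero. *)
Lemma le_mean_const (R : realFieldType) (I : finType) (A : {set I})
    (x : I -> R) :
  (forall i, i \in A -> #|A|%:R * x i <= \sum_(j in A) x j) ->
  {in A &, forall i j, x i = x j}.
Proof.
move=> le_mean; set S := \sum_(j in A) x j.
have xE i : i \in A -> #|A|%:R * x i = S.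
  move=> iA; apply/esym/eqP; rewrite -subr_eq0; apply/eqP.
  have gap_ge0 j : j \in A -> 0 <= S - #|A|%:R * x j.
    by move=> jA; rewrite subr_ge0 le_mean.
  apply: (psumr_eq0P gap_ge0) => //.
  by rewrite sumrB sumr_const -mulr_sumr mulr_natl subrr.
move=> i j iA jA; have A0 : #|A|%:R != 0 :> R.
  by rewrite pnatr_eq0 -lt0n; apply/card_gt0P; exists i.
by apply: (mulfI A0); rewrite !xE.
Qed.

(** Connectedness of the Johnson graph on the sets through [i]: an exchange
    step [T :\ a] to [T :\ b] with [a], [b] both different from [i] never
    leaves the star, and brings [A] closer to [B]. *)
Lemma exchange_const (V : finType) (X : Type) (c : {set V} -> X) (i : V) :
  forall k : nat,
  (forall (T : {set V}) (a b : V), #|T| = k.+1 -> i \in T ->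
     a \in T :\ i -> b \in T :\ i -> c (T :\ a) = c (T :\ b)) ->
  forall A B : {set V},
    #|A| = k -> #|B| = k -> i \in A -> i \in B -> c A = c B.
Proof.
move=> k exch A B; move Dp: #|B :\: A| => p.
elim: p A Dp => [|p IHp] A Dp cA cB iA iB.
  congr c; apply/esym/eqP; rewrite eqEcard cA cB leqnn andbT.
  by rewrite -finset.setD_eq0 -cards_eq0 Dp.
have [b] : exists b, b \in B :\: A by apply/card_gt0P; rewrite Dp.
rewrite inE => /andP[bA bB].
have [a] : exists a, a \in A :\: B.
  by apply/card_gt0P; rewrite -(@ltn_add2l #|A :&: B|) cardsID addn0 cA -cB
    -(cardsID A B) finset.setIC Dp -[ltnLHS]addn0 ltn_add2l.
rewrite inE => /andP[aB aA].
have ab : a != b by apply: contraNneq aB => ->.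
have ia : i != a by apply: contraNneq aB => <-.
have ib : i != b by apply: contraNneq bA => <-.
have cT : #|b |: A| = k.+1 by rewrite cardsU1 bA cA.
rewrite -[A in LHS](setU1K bA) -(exch (b |: A) a b) //; first last.
- by rewrite !inE eqxx eq_sym ib.
- by rewrite !inE aA orbT eq_sym ia.
- by rewrite inE iA orbT.
apply: IHp => //.
- have -> : B :\: ((b |: A) :\ a) = (B :\: A) :\ b.
    apply/setP => y; rewrite !inE; have [->|yb] := eqVneq y b.
      by rewrite [b == a]eq_sym ab.
    by have [->|ya] := eqVneq y a; rewrite ?(negPf aB) ?andbF.
  by apply/eqP; rewrite -eqSS -Dp (cardsD1 b (B :\: A)) inE bA bB.
- by apply/eqP; rewrite -eqSS -cT (cardsD1 a (b |: A)) !inE aA orbT.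
- by rewrite !inE ia iA orbT.
Qed.

Section Extremality.
Variables (R : realFieldType) (n m : nat) (i : 'I_n).
Implicit Types d : vec R n m.+1.

(** At [(T, j)], either [i \notin T :\ j] and the left-hand side is 0, or the
    simplex inequality is an equality: all the [m + 1] terms of the sum are 1,
    except the one that omits [i]. *)
Lemma star_SMET : SMET m%:R (star R m.+1 i).
Proof.
split=> [T j cT jT|A cA]; last by rewrite coord_at_star ?ler0n.
have cTD a : a \in T -> #|T :\ a| = m.+1.
  by move=> aT; apply/eqP; rewrite -eqSS -cT (cardsD1 a T) aT.
have starD a : a \in T -> coord_at (star R m.+1 i) (T :\ a) = (i \in T :\ a)%:R.
  by move=> aT; rewrite coord_at_star ?cTD.
rewrite /simplex_ineq starD //.
have inT a : a \in T :\ j -> a \in T by rewrite inE => /andP[].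
case: (boolP (i \in T :\ j)) => [iTj|_]; last first.
  by rewrite mulr0 sumr_ge0 // => a /inT aT; rewrite starD ?ler0n.
rewrite (big_setD1 i iTj) /= starD ?inT // !inE eqxx add0r mulr1.
rewrite (eq_bigr (fun=> 1)) => [|a aTji].
  rewrite sumr_const ler_nat -ltnS -(cTD j jT).
  by rewrite (cardsD1 i (T :\ j)) iTj.
have [ai aTj] := setD1P aTji.
by rewrite starD ?inT // !inE eq_sym ai inT.
Qed.

(** The linear form of the face: it adds up the non-negativity constraints that
    are tight at the star; the tight simplex inequalities follow from these
    ([face_exchange]). *)
Definition off_star d : R^o := \sum_(S : ksubset n m.+1 | i \notin val S) d S.

Fact off_star_is_linear : linear off_star.
Proof.
move=> l d e; rewrite /off_star scaler_sumr -big_split /=.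
by apply: eq_bigr => S _; rewrite !ffunE.
Qed.
HB.instance Definition _ :=
  GRing.isLinear.Build R (vec R n m.+1) R^o _ off_star off_star_is_linear.

Lemma SMETZ (s l : R) d : 0 <= l -> SMET s d -> SMET s (l *: d).
Proof.
move=> l0 [ds d0]; split=> [T j cT jT|A cA]; last first.
  by rewrite coord_atZ mulr_ge0 ?d0.
rewrite /simplex_ineq coord_atZ mulrCA.
rewrite (eq_bigr (fun a => l * coord_at d (T :\ a))) => [|a _].
  by rewrite -mulr_sumr ler_wpM2l //; apply: ds.
by rewrite coord_atZ.
Qed.

Lemma SMET_coord_ge0 (s : R) d (S : ksubset n m.+1) : SMET s d -> 0 <= d S.
Proof. by move=> [_ d0]; rewrite -coord_at_val d0 ?card_ksubset. Qed.

Lemma off_star_ge0 d : SMET m%:R d -> 0 <= off_star d.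
Proof. by move=> dC; apply: sumr_ge0 => S _; apply: SMET_coord_ge0 dC. Qed.

Lemma off_star_eq0 d (S : ksubset n m.+1) :
  SMET m%:R d -> off_star d = 0 -> i \notin val S -> d S = 0.
Proof.
move=> dC f0 iS; apply: (psumr_eq0P _ f0) => // B _.
exact: SMET_coord_ge0 dC.
Qed.

Lemma face_exchange d (T : {set 'I_n}) (a b : 'I_n) :
  SMET m%:R d -> off_star d = 0 -> #|T| = m.+2 -> i \in T ->
  a \in T :\ i -> b \in T :\ i -> coord_at d (T :\ a) = coord_at d (T :\ b).
Proof.
move=> dC f0 cT iT.
have cTi : #|T :\ i| = m.+1.
  by apply/eqP; rewrite -eqSS -cT (cardsD1 i T) iT.
have d0 : coord_at d (T :\ i) = 0.
  move/eqP: cTi => cTi; rewrite -(SubK (ksubset n m.+1) cTi) coord_at_val.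
  by apply: off_star_eq0 => //; rewrite SubK setD11.
move: a b; apply: (@le_mean_const _ _ _ (fun a => coord_at d (T :\ a))) => a.
rewrite inE => /andP[_ aT]; have [/(_ T a cT aT) simp _] := dC.
(* the simplex inequality at (T, a), with d (T :\ a) added to both sides *)
rewrite cTi -natr1 mulrDl mul1r.
have -> : \sum_(j in T :\ i) coord_at d (T :\ j)
        = \sum_(j in T) coord_at d (T :\ j).
  by rewrite (big_setD1 i iT) /= d0 add0r.
by rewrite (big_setD1 a aT) /= [leLHS]addrC lerD2l.
Qed.

Lemma face_subset_ray d : SMET m%:R d -> off_star d = 0 -> ray (star R m.+1 i) d.
Proof.
move=> dC f0; pose inS (S : ksubset n m.+1) := i \in val S.
(* l = 0 is right when no set contains i: then d and the star are both 0 *)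
pose l := if [pick S | inS S] is Some B then d B else 0.
exists l.
  by rewrite /l /=; case: pickP => [S _|_] //; apply: SMET_coord_ge0 dC.
apply/ffunP => S; rewrite !ffunE; case: (boolP (i \in val S)) => iS; last first.
  by rewrite (off_star_eq0 dC f0 iS) scaler0.
rewrite /l; case: pickP => [B iB|/(_ S)]; last by rewrite /inS iS.
have exch := face_exchange dC f0.
rewrite -[d S]coord_at_val -[d B]coord_at_val [LHS]mulr1.
by apply: (exchange_const exch) => //; apply: card_ksubset.
Qed.

Lemma star_neq0 : (m.+1 <= n)%N -> star R m.+1 i != 0.
Proof.
move=> mn; have : (0 < #|[set A : {set 'I_n} | A \subset ~: [set i] & #|A| == m]|)%N.
  rewrite cards_draws bin_gt0 cardsC1 card_ord -ltnS.
  by case: n i mn => [[]|].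
case/card_gt0P => A; rewrite inE => /andP[/fintype.subsetP Ai /eqP cA].
have cS : #|i |: A| == m.+1.
  by rewrite cardsU1 cA; case: (boolP (i \in A)) => // /Ai; rewrite !inE eqxx.
apply/eqP => /ffunP/(_ (exist _ (i |: A) cS))/eqP.
by rewrite !ffunE /= setU11 oner_eq0.
Qed.

Lemma star_is_extreme_ray :
  (m.+1 <= n)%N ->
  is_extreme_ray (SMET m%:R : set (vec R n m.+1)) (ray (star R m.+1 i)).
Proof.
move=> mn; split.
  exists off_star; split; first exact: off_star_ge0.
  apply/seteqP; split=> [_ [l /= l0 <-]|d [dC f0]]; last exact: face_subset_ray.
  split; first exact/SMETZ/star_SMET.
  apply: big1 => S /negPf iS; by rewrite !ffunE iS scaler0.
exists <[star R m.+1 i : vec R n m.+1]>%VS; split.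
- by move=> _ [l _ <-]; rewrite memvZ ?memv_line.
- move=> W rayW; rewrite -memvE; apply: rayW.
  by exists 1; rewrite ?scale1r //= ler01.
- by rewrite dim_vline star_neq0.
Qed.

End Extremality.

(** * The support graph *)

Section Link.
Variables (n : nat) (i : 'I_n).

(** [lift i] identifies ['I_n.-1] with the points other than [i], so that
    [link] deletes [i] from a set and [cone] adds it back. *)
Definition link (A : {set 'I_n}) : {set 'I_n.-1} := lift i @^-1: A.
Definition cone (B : {set 'I_n.-1}) : {set 'I_n} := i |: lift i @: B.

Lemma notin_lift_imset (B : {set 'I_n.-1}) : i \notin lift i @: B.
Proof. by apply/imsetP => -[j _ /eqP]; rewrite (negPf (neq_lift i j)). Qed.

Lemma card_cone (B : {set 'I_n.-1}) : #|cone B| = #|B|.+1.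
Proof.
by rewrite cardsU1 notin_lift_imset card_imset //; apply: lift_inj.
Qed.

Lemma linkK (A : {set 'I_n}) : i \in A -> cone (link A) = A.
Proof.
move=> iA; apply/setP => x; rewrite !inE.
case: (unliftP i x) => [j ->|->]; last by rewrite eqxx iA.
by rewrite eq_sym (negPf (neq_lift i j)) mem_imset ?inE //; apply: lift_inj.
Qed.

Lemma coneK : cancel cone link.
Proof.
move=> B; apply/setP => j; rewrite !inE eq_sym (negPf (neq_lift i j)).
by rewrite mem_imset //; apply: lift_inj.
Qed.

Lemma card_link (A : {set 'I_n}) : i \in A -> #|link A|.+1 = #|A|.
Proof. by move=> iA; rewrite -card_cone linkK. Qed.

End Link.

Lemma star_graph_iso (R : realFieldType) (n m : nat) (i : 'I_n) :
  graph_iso (@supp_adj R n m.+1 (star R m.+1 i)) (@johnson_adj n.-1 m).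
Proof.
have in_supp (S : supp (star R m.+1 i)) : i \in val (val S).
  by have := valP S; rewrite ffunE pnatr_eq0 eqb0 negbK.
have cL (S : supp (star R m.+1 i)) : #|link i (val (val S))| == m.
  by rewrite -eqSS card_link ?in_supp ?card_ksubset.
have cC (B : ksubset n.-1 m) : #|cone i (val B)| == m.+1.
  by rewrite card_cone card_ksubset.
have suppC (B : ksubset n.-1 m) :
    star R m.+1 i (exist _ (cone i (val B)) (cC B)) != 0.
  by rewrite ffunE /= setU11 oner_eq0.
exists (fun S => exist _ (link i (val (val S))) (cL S) : ksubset n.-1 m).
  exists (fun B => exist _ (exist _ (cone i (val B)) (cC B)) (suppC B)).
    by move=> S; do 2 apply: val_inj => /=; rewrite linkK ?in_supp.
  by move=> B; apply: val_inj => /=; rewrite coneK.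
move=> S S'; rewrite /supp_adj /johnson_adj /= -preimsetI.
by rewrite (card_link (A := _ :&: _)) ?eqSS // inE !in_supp.
Qed.

(** * The orbit *)

Section Orbit.
Variables (R : realFieldType) (n k : nat).

Lemma perm_vec_star (s : 'S_n) (l : R) (i : 'I_n) :
  perm_vec s (l *: star R k i) = l *: star R k (s i).
Proof.
apply/ffunP => S; rewrite !ffunE /=; congr (_ *: (nat_of_bool _)%:R).
by rewrite -{1}[i](permK s) mem_imset //; apply: perm_inj.
Qed.

Lemma perm_ray_star (s : 'S_n) (i : 'I_n) :
  [set perm_vec s x | x in ray (star R k i)] = ray (star R k (s i)).
Proof.
apply/seteqP; split=> [_ [_ [l l0 <-] <-]|_ [l l0 <-]].
  by exists l; rewrite ?perm_vec_star.
by exists (l *: star R k i); [exists l|rewrite perm_vec_star].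
Qed.

Lemma ray_orbit_star (i : 'I_n) :
  ray_orbit (star R k i) = [set ray (star R k j) | j in [set: 'I_n]].
Proof.
apply/seteqP; split=> [_ [s _ <-]|_ [j _ <-]].
  by exists (s i); rewrite ?perm_ray_star.
by exists (tperm i j); rewrite ?perm_ray_star ?tpermL.
Qed.

End Orbit.

Lemma ray_star_inj (R : realFieldType) (n k : nat) :
  (k.+2 <= n)%N -> injective (fun i : 'I_n => ray (star R k.+1 i)).
Proof.
move=> kn i j /= rays_eq; apply/eqP/negPn/negP => ij.
have : ray (star R k.+1 i) (star R k.+1 i).
  by exists 1; rewrite ?scale1r //= ler01.
rewrite rays_eq => -[l _ star_ij].
have [A [cA iA jA]] := exists_separating_subset ij kn.
have := congr1 (fun d => coord_at d A) star_ij.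
rewrite coord_atZ !coord_at_star // iA (negPf jA) mulr0.
by move/esym/eqP; rewrite oner_eq0.
Qed.

Lemma card_ray_orbit_star (R : realFieldType) (n k : nat) (i : 'I_n) :
  (k.+2 <= n)%N -> ray_orbit (star R k.+1 i) #= `I_n.
Proof.
move=> kn; rewrite ray_orbit_star.
apply: card_eq_trans (card_esym card_II).
by apply: inj_card_eq => a b _ _; apply: ray_star_inj.
Qed.

Theorem proposition3 (R : realType) (m n : nat)
    (hm : (1 <= m)%N) (hn : (m + 3 <= n)%N) :
  let v : vec R n m.+1 := star_vec R n m.+1 in
  [/\ is_extreme_ray (@SMET R n m m%:R) (ray v),
      graph_iso (@supp_adj R n m.+1 v) (@johnson_adj n.-1 m)
    & ray_orbit v #= `I_n].
Proof.
have n0 : (0 < n)%N by apply: leq_trans hn; rewrite addn3.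
have mn : (m.+2 <= n)%N by apply: leq_trans hn; rewrite addn3.
rewrite /= (@star_vecE R n m.+1 (Ordinal n0)) //; split.
- exact/star_is_extreme_ray/ltnW.
- exact: star_graph_iso.
- exact: card_ray_orbit_star.
Qed.
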